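(* In the edge-distinguishing game (EDGe) played on the path $P_5$ (with $\lambda(P_5)$ colors), Player 1 has a winning strategy.
   Context: $P_n$ is the path on $n$ vertices. For a positive integer $k$ let $[k]=\{1,\dots,k\}$. A $k$-coloring $c:V(G)\to[k]$ induces $c'(\{u,v\})=\{c(u),c(v)\}$ (a multiset); $c$ is edge-distinguishing if $c'$ is injective, and $\lambda(G)$ is the least $k$ admitting such a coloring. A partial coloring on $U\subseteq V(G)$ has partial induced edge coloring on $G[U]$. EDGe on $G$: two players, Player 1 first, alternately color an uncolored vertex with a color from $[\lambda(G)]$; a move is legal iff afterwards the partial induced edge coloring of the colored vertices is injective. The player making the last legal move wins. A winning strategy guarantees a win regardless of the opponent's play. *)

(* Defs.v *)
From HB Require Import structures.
From mathcomp Require Import all_boot.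
From mathcomp Require Import finmap multiset.

Set Implicit Arguments.
Unset Strict Implicit.
Unset Printing Implicit Defensive.

Local Open Scope mset_scope.

Record sgraph := SGraph {
  vertex :> finType;
  adj : rel vertex;
  adj_sym : symmetric adj;
  adj_irr : irreflexive adj
}.

Definition edges (G : sgraph) : {set {set G}} :=
  [set [set p.1; p.2] | p : G * G & adj p.1 p.2].

(* The edges of the induced subgraph G[U]. *)
Definition edges_in (G : sgraph) (U : {set G}) : {set {set G}} :=
  [set e in edges G | e \subset U].

(* c'({u,v}) is the multiset {c(u), c(v)}. *)
Definition induced (G : sgraph) (C : choiceType) (c : G -> C) (e : {set G}) :
  {mset C} := seq_mset [seq c u | u <- enum e].

Section Lambda.
Variable G : sgraph.

Definition edge_distinguishing k (c : G -> 'I_k) : bool :=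
  dinjectiveb (induced c) (mem (edges G)).

Definition edge_colorable k : bool :=
  (0 < k) && [exists c : {ffun G -> 'I_k}, edge_distinguishing c].

Lemma edge_colorable_ex : exists k, edge_colorable k.
Proof.
exists #|G|.+1; apply/andP; split=> //; apply/existsP.
pose c := [ffun u : G => widen_ord (leqnSn #|G|) (enum_rank u)].
have c_inj : injective c.
  by move=> u v; rewrite !ffunE => /(congr1 val) /= /val_inj /enum_rank_inj.
exists c; apply/dinjectiveP => e f _ _ /eq_seq_msetP eq_ef.
apply/setP => u; rewrite -[u \in e]mem_enum -[u \in f]mem_enum.
by rewrite -(mem_map c_inj) (perm_mem eq_ef) (mem_map c_inj).
Qed.

Definition lambda : nat := ex_minn edge_colorable_ex.

End Lambda.

Section Game.
Variables (G : sgraph) (k : nat).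

(* The uncolored vertices are those mapped to None. *)
Definition partial_coloring := {ffun G -> option 'I_k}.

Definition colored (f : partial_coloring) : {set G} := [set u | f u].

Definition partially_distinguishing (f : partial_coloring) : bool :=
  dinjectiveb (induced f) (mem (edges_in (colored f))).

Definition move := (G * 'I_k)%type.

Definition make_move (f : partial_coloring) (m : move) : partial_coloring :=
  [ffun u => if u == m.1 then Some m.2 else f u].

Definition legal (f : partial_coloring) (m : move) : bool :=
  (m.1 \notin colored f) && partially_distinguishing (make_move f m).

Definition position (p : seq move) : partial_coloring :=
  foldl make_move [ffun => None] p.

Definition legal_play (p : seq move) : Prop :=
  forall q m, prefix (rcons q m) p -> legal (position q) m.

Definition game_over (p : seq move) : bool :=
  [forall m, ~~ legal (position p) m].

(* Player 1 makes the moves of index 0, 2, 4, ..., hence is to move after p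
   when size p is even, and has made the last move of p when it is odd. *)
Definition to_move1 (p : seq move) : bool := ~~ odd (size p).
Definition last_move1 (p : seq move) : bool := odd (size p).

Definition strategy := seq move -> move.

Definition follows1 (s : strategy) (p : seq move) : Prop :=
  forall q m, prefix (rcons q m) p -> to_move1 q -> m = s q.

(* The first clause rules out strategies that get stuck on illegal advice.
   Every legal play is finite, each move coloring a new vertex. *)
Definition winning1 (s : strategy) : Prop :=
  forall p, legal_play p -> follows1 s p ->
    (~~ game_over p -> to_move1 p -> legal (position p) (s p)) /\
    (game_over p -> last_move1 p).

End Game.

Definition EDGe_player1_wins (G : sgraph) : Prop :=
  exists s : strategy G (lambda G), winning1 s.

Section Path.
Variable n : nat.

Definition path_adj : rel 'I_n :=
  fun i j => (i.+1 == j :> nat) || (j.+1 == i :> nat).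

Lemma path_adj_sym : symmetric path_adj.
Proof. by move=> i j; rewrite /path_adj orbC. Qed.

Lemma path_adj_irr : irreflexive path_adj.
Proof. by move=> i; rewrite /path_adj orbb gtn_eqF. Qed.

Definition path_graph : sgraph := SGraph path_adj_sym path_adj_irr.

End Path.

(* Main.v *)
From mathcomp Require Import all_boot zify.
From mathcomp Require Import finmap multiset.
Require Import Defs.

(** Four edges need four distinct color pairs and two colors give only three,
so [lambda] of the path is 3. The game then has at most 15 * 12 * 9 * 6 * 3
plays, and is solved by backward induction, run on positions encoded as words
over [option nat]. *)

Set Implicit Arguments.
Unset Strict Implicit.
Unset Printing Implicit Defensive.

(** * From a backward-induction win to a strategy *)

Section BackwardInduction.
Variables (G : sgraph) (k : nat).
Implicit Types (f : partial_coloring G k) (p q : seq (move G k)).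

(* The player to move after [f] can force a win making at most [N] moves. *)
Fixpoint wins (N : nat) f : bool :=
  if N is N'.+1 then
    [exists m, legal f m &&
      [forall m', legal (make_move f m) m' ==>
                  wins N' (make_move (make_move f m) m')]]
  else false.

Definition winning_move N f (m : move G k) : bool :=
  legal f m && [forall m', legal (make_move f m) m' ==>
                           wins N.-1 (make_move (make_move f m) m')].

Lemma wins_winning_move N f : wins N f -> exists m, winning_move N f m.
Proof. by case: N => // N /existsP. Qed.

(* [m0] is never played from a winning position: it only makes [solver] total. *)
Definition solver N (m0 : move G k) : strategy G k := fun p =>
  odflt m0 [pick m | winning_move (N - (size p)./2) (position p) m].

Lemma solver_winning_move N m0 p : wins (N - (size p)./2) (position p) ->
  winning_move (N - (size p)./2) (position p) (solver N m0 p).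
Proof.
move=> /wins_winning_move [m mP]; rewrite /solver; case: pickP => //= nP.
by rewrite nP in mP.
Qed.

Lemma position_rcons p m : position (rcons p m) = make_move (position p) m.
Proof. by rewrite /position foldl_rcons. Qed.

Lemma prefix_rcons_trans q p (m : move G k) :
  prefix q p -> prefix q (rcons p m).
Proof. by move=> h; apply: prefix_trans h (prefix_rcons _ _). Qed.

(** Player 1 has made [(size p)./2] moves whenever it is Player 1's turn, so the budget left is
    [N - (size p)./2]. At Player 2's turn the invariant looks one move ahead, to the position after
    each legal reply. *)
Lemma solver_invariant N m0 p : wins N [ffun => None] ->
  legal_play p -> follows1 (solver N m0) p ->
  if to_move1 p then is_true (wins (N - (size p)./2) (position p))
  else forall m, legal (position p) m ->
         wins (N - (size p).+1./2) (make_move (position p) m).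
Proof.
move=> winN; elim/last_ind: p => [|p m IHp] legp follp; first by rewrite subn0.
have{IHp} := IHp (fun q m' h => legp q m' (prefix_rcons_trans _ h))
                (fun q m' h => follp q m' (prefix_rcons_trans _ h)).
have legm := legp p m (prefix_refl _); have follm := follp p m (prefix_refl _).
rewrite /to_move1 size_rcons /= position_rcons negbK.
(* For odd [size p], [m] is a reply by Player 2, already covered by the induction hypothesis. *)
case: ifPn => [even_p win_p|]; last first.
  by rewrite negbK => -> /(_ m legm).
rewrite (negbTE even_p) => m' legm'.
(* Here [m] is the solver's own move, which spends one unit of the budget. *)
have := solver_winning_move m0 win_p; rewrite -(follm even_p).
by case/andP=> _ /forallP/(_ m')/implyP/(_ legm'); rewrite -subnS.
Qed.

Lemma wins_winning1 N (m0 : move G k) :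
  wins N [ffun => None] -> exists s : strategy G k, winning1 s.
Proof.
move=> winN; exists (solver N m0) => p legp follp.
have := solver_invariant winN legp follp; case: ifPn => [to1 win_p|].
  (* A winning move is legal, so the game cannot be over at Player 1's turn. *)
  have /andP[leg_s _] := solver_winning_move m0 win_p.
  by split=> // /forallP/(_ (solver N m0 p)); rewrite leg_s.
by rewrite /to_move1 /last_move1 negbK => ->.
Qed.

End BackwardInduction.

Lemma perm_eq_map (T T' : eqType) (h : T -> T') (s t : seq T) :
  injective h -> perm_eq (map h s) (map h t) = perm_eq s t.
Proof.
by move=> h_inj; apply/idP/idP; [apply: perm_map_inj | apply: perm_map].
Qed.

(** * Edges of a path and their color multisets *)

Section PathEdges.
Variable n : nat.
Implicit Types i j : 'I_n.

Definition path_edge i : {set path_graph n.+1} :=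
  [set (widen_ord (leqnSn n) i : path_graph n.+1); lift ord0 i].

Lemma path_edge_neq i : widen_ord (leqnSn n) i != lift ord0 i.
Proof. by rewrite -val_eqE /= /bump /= add1n neq_ltn ltnSn. Qed.

Lemma path_edge_inj : injective path_edge.
Proof.
(* Each of [i], [j] lies in the other's edge; [i = j + 1] and [j = i + 1] cannot both hold. *)
move=> i j /setP eq_ij; apply/val_inj/eqP; rewrite /= eqn_leq.
have := eq_ij (widen_ord (leqnSn n) i); have := eq_ij (widen_ord (leqnSn n) j).
rewrite !inE -!val_eqE /= /bump /= !add1n !eqxx /=.
by case/orP=> /eqP-> /esym/orP[]/eqP; lia.
Qed.

Lemma edges_path : edges (path_graph n.+1) = [set path_edge i | i : 'I_n].
Proof.
apply/setP=> e; apply/imsetP/imsetP => [[[u v]]|[i _ ->]]; last first.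
  exists (widen_ord (leqnSn n) i, lift ord0 i) => //.
  by rewrite inE /= /path_adj /= /bump /= add1n eqxx.
have succE (a b : 'I_n.+1) : a.+1 = b -> exists i,
    a = widen_ord (leqnSn n) i /\ b = lift ord0 i.
  move=> ab; have an : a < n by rewrite -ltnS ab.
  by exists (Ordinal an); split; apply: val_inj; rewrite /= /bump ?add1n.
rewrite inE /= => /orP[]/eqP/succE[i [-> ->]] ->; exists i => //.
by rewrite setUC.
Qed.

(** The order in which [enum] lists the two endpoints is irrelevant to the multiset, so they may be
    listed as [i], [i + 1]. *)
Lemma induced_path_edge (C : choiceType) (c : path_graph n.+1 -> C) i j :
  (induced c (path_edge i) == induced c (path_edge j)) =
  perm_eq [:: c (widen_ord (leqnSn n) i); c (lift ord0 i)]
          [:: c (widen_ord (leqnSn n) j); c (lift ord0 j)].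
Proof.
have enumE l : perm_eq (enum (path_edge l))
    [:: widen_ord (leqnSn n) l; lift ord0 l].
  apply: uniq_perm; rewrite ?enum_uniq //= ?inE ?path_edge_neq // => u.
  by rewrite mem_enum !inE.
rewrite /induced; apply/eqP/idP => [/eq_seq_msetP h|h].
  rewrite -![[:: c _; c _]]/(map c [:: _; _]).
  by rewrite -(permPl (perm_map c (enumE i))) -(permPr (perm_map c (enumE j))).
apply/eq_seq_msetP; rewrite (permPl (perm_map c (enumE i))).
by rewrite (permPr (perm_map c (enumE j))).
Qed.

End PathEdges.

(** * Positions as words, and the search on words *)

Definition clash (e e' : option nat * option nat) : bool :=
  [&& isSome e.1, isSome e.2, isSome e'.1, isSome e'.2 &
      perm_eq [:: e.1; e.2] [:: e'.1; e'.2]].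

(** The zip lists the edges in path order, and [pairwise] tests each pair of positions once, the
    earlier edge first. *)
Definition distinguishing_word (s : seq (option nat)) : bool :=
  pairwise (fun e e' => ~~ clash e e') (zip s (behead s)).

Definition legal_word (s : seq (option nat)) (m : nat * nat) : bool :=
  ~~ isSome (nth None s m.1) &&
  distinguishing_word (set_nth None s m.1 (Some m.2)).

Section PathWords.
Variables n k : nat.
Implicit Types (f : partial_coloring (path_graph n.+1) k).
Implicit Types (m : move (path_graph n.+1) k).

Definition word f : seq (option nat) :=
  [seq omap val (f u) | u <- enum 'I_n.+1].

Lemma size_word f : size (word f) = n.+1.
Proof. by rewrite size_map size_enum_ord. Qed.

Lemma nth_word f (u : 'I_n.+1) : nth None (word f) u = omap val (f u).
Proof. by rewrite (nth_map u) ?size_enum_ord // nth_ord_enum. Qed.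

Lemma word_make_move f m :
  word (make_move f m) = set_nth None (word f) m.1 (Some (val m.2)).
Proof.
have szE : size (set_nth None (word f) m.1 (Some (val m.2))) = n.+1.
  by rewrite size_set_nth size_word; apply/maxn_idPr.
apply: (@eq_from_nth _ None); rewrite size_word ?szE // => i ltin.
rewrite -[i]/(val (Ordinal ltin)) nth_word ffunE nth_set_nth /= -val_eqE /=.
by case: eqP => //= _; rewrite -[i]/(val (Ordinal ltin)) nth_word.
Qed.

(** Entry [i] of the zip holds the colors at the two ends of [path_edge i], and [omap val] is
    injective, so passing to [nat] preserves equality of multisets. *)
Lemma clash_word f (i j : 'I_n) :
  clash (nth (None, None) (zip (word f) (behead (word f))) i)
        (nth (None, None) (zip (word f) (behead (word f))) j) =
  [&& path_edge i \subset colored f, path_edge j \subset colored f &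
      induced f (path_edge i) == induced f (path_edge j)].
Proof.
have nthE (l : 'I_n) : nth (None, None) (zip (word f) (behead (word f))) l =
    (omap val (f (widen_ord (leqnSn n) l)), omap val (f (lift ord0 l))).
  rewrite nth_zip_cond size_zip size_behead size_word /= ltn_min ltn_ord.
  rewrite ltnW ?ltnS //= nth_behead.
  rewrite -[X in nth _ _ X]/(val (widen_ord (leqnSn n) l)).
  rewrite -[in X in (_, X)](add1n l) -[1 + l]/(val (lift ord0 l)).
  by rewrite !nth_word.
have isSome_omap (o : option 'I_k) : isSome (omap val o) = isSome o by case: o.
have omap_inj : injective (omap (@nat_of_ord k)) by apply: inj_omap val_inj.
rewrite !nthE /clash /= !isSome_omap induced_path_edge.
rewrite -![[:: omap _ _; _]]/(map (omap val) [:: _; _]) perm_eq_map //.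
by rewrite /path_edge !subUset !sub1set !inE -!andbA.
Qed.

Lemma partially_distinguishing_word f :
  partially_distinguishing f = distinguishing_word (word f).
Proof.
have szE : size (zip (word f) (behead (word f))) = n.
  by rewrite size_zip size_behead size_word; apply/minn_idPr.
apply/dinjectiveP/(pairwiseP (None, None)) => [inj i j|clashF e e'].
  rewrite !inE szE => ltin ltjn ltij.
  rewrite -[i]/(val (Ordinal ltin)) -[j]/(val (Ordinal ltjn)) clash_word.
  apply/and3P=> -[iU jU /eqP/inj eq_ij].
  suff /path_edge_inj[eqij] : path_edge (Ordinal ltin) =
      path_edge (Ordinal ltjn).
    by rewrite eqij ltnn in ltij.
  by apply: eq_ij; rewrite inE edges_path imset_f.
rewrite !inE edges_path => /andP[/imsetP[i _ ->] iU] /andP[/imsetP[j _ ->] jU].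
(* [pairwise] speaks only of increasing indices, hence the two symmetric cases. *)
move=> eq_ij; case: (ltngtP i j) => [ltij|ltji|/val_inj-> //].
  have := clashF i j; rewrite !inE szE !ltn_ord clash_word iU jU eq_ij eqxx.
  by move=> /(_ isT isT ltij).
have := clashF j i; rewrite !inE szE !ltn_ord clash_word iU jU eq_ij eqxx.
by move=> /(_ isT isT ltji).
Qed.

Lemma legal_wordE f m : legal f m = legal_word (word f) (val m.1, val m.2).
Proof.
rewrite /legal partially_distinguishing_word word_make_move /legal_word /=.
by rewrite nth_word inE; case: (f m.1).
Qed.

Definition word_moves : seq (nat * nat) :=
  [seq (i, a) | i <- iota 0 n.+1, a <- iota 0 k].

Fixpoint wins_word (N : nat) (s : seq (option nat)) : bool :=
  if N is N'.+1 then
    has (fun m : nat * nat => legal_word s m &&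
      let s1 := set_nth None s m.1 (Some m.2) in
      all (fun m' : nat * nat => legal_word s1 m' ==>
                     wins_word N' (set_nth None s1 m'.1 (Some m'.2)))
          word_moves) word_moves
  else false.

Lemma wins_wordW N f : wins_word N (word f) -> wins N f.
Proof.
elim: N f => //= N IHN f /hasP[_ /allpairsP[[i a] [] + + ->]].
rewrite !mem_iota /fst /snd !add0n /= => lti lta /andP[leg /allP win].
apply/existsP; exists (Ordinal lti : path_graph n.+1, Ordinal lta).
rewrite legal_wordE leg /=; apply/forallP=> m'; apply/implyP=> leg'.
apply: IHN; rewrite !word_make_move /=.
apply: (implyP (win (val m'.1, val m'.2) _)); last first.
  by move: leg'; rewrite legal_wordE word_make_move.
by apply/allpairsP; exists (val m'.1, val m'.2); rewrite !mem_iota !ltn_ord.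
Qed.

(** A total coloring is a partial one whose colored vertices induce the whole path, and [Some] is
    injective. *)
Lemma edge_distinguishing_word (c : path_graph n.+1 -> 'I_k) :
  edge_distinguishing c =
  distinguishing_word [seq Some (val (c u)) | u <- enum 'I_n.+1].
Proof.
pose f : partial_coloring (path_graph n.+1) k := [ffun u => Some (c u)].
have -> : [seq Some (val (c u)) | u <- enum 'I_n.+1] = word f.
  by apply: eq_map => u; rewrite ffunE.
have edges_colored e : (e \in edges_in (colored f)) =
    (e \in edges (path_graph n.+1)).
  rewrite inE andb_idr // => _; apply/subsetP=> u _; by rewrite inE ffunE.
have indE e e' : (induced f e = induced f e') <-> (induced c e = induced c e').
  have fE (x : {set path_graph n.+1}) :
      [seq f u | u <- enum x] = map Some [seq c u | u <- enum x].
    by rewrite -map_comp; apply: eq_map => u; rewrite /= ffunE.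
  have permE s t := @perm_eq_map _ _ (@Some 'I_k) s t Some_inj.
  rewrite /induced !fE; split=> /eq_seq_msetP h; apply/eq_seq_msetP.
    by rewrite -permE.
  by rewrite permE.
rewrite -partially_distinguishing_word.
apply/dinjectiveP/dinjectiveP => inj e e' eE eE' /indE; apply: inj.
- by rewrite -[_ \in _]edges_colored.
- by rewrite -[_ \in _]edges_colored.
- by rewrite [_ \in _]edges_colored.
- by rewrite [_ \in _]edges_colored.
Qed.

End PathWords.

(** * The path on five vertices *)

Lemma enum_ord5 : enum 'I_5 =
  [:: inord 0; inord 1; inord 2; inord 3; inord 4].
Proof.
by apply: (inj_map val_inj); rewrite val_enum_ord /= !inordK.
Qed.

Lemma two_colors_clash (a b c d e : bool) :
  ~~ distinguishing_word
      [seq Some (nat_of_bool x) | x <- [:: a; b; c; d; e]].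
Proof. by case: a; case: b; case: c; case: d; case: e. Qed.

Lemma lambda_path5 : lambda (path_graph 5) = 3.
Proof.
rewrite /lambda; case: ex_minnP => k /andP[k_gt0 /existsP[c cP]] k_min.
apply/eqP; rewrite eqn_leq; apply/andP; split.
  apply: k_min; apply/existsP.
  (* The edges receive the distinct pairs 00, 01, 11, 12. *)
  exists [ffun u : 'I_5 => inord (nth 0 [:: 0; 0; 1; 1; 2] u)].
  by rewrite edge_distinguishing_word enum_ord5 /= !ffunE /= !inordK.
rewrite leqNgt; apply/negP=> k_lt3.
(* With at most two colors a color is a truth value, which leaves the 32 Boolean words to refute. *)
have boolE u : val (c u) = nat_of_bool (0 < val (c u)).
  have := leq_trans (ltn_ord (c u)) (k_lt3 : k <= 2) => /=.
  by case: (nat_of_ord (c u)) => [|[]].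
move: cP; rewrite edge_distinguishing_word enum_ord5; apply/negP.
rewrite /= (boolE (inord 0)) (boolE (inord 1)) (boolE (inord 2)).
by rewrite (boolE (inord 3)) (boolE (inord 4)); apply: two_colors_clash.
Qed.

Theorem theorem3p10 : EDGe_player1_wins (path_graph 5).
Proof.
rewrite /EDGe_player1_wins lambda_path5.
(* The first 3 counts colors; the second bounds Player 1's moves, since five vertices allow at most
   three of them. *)
apply: (@wins_winning1 (path_graph 5) 3 3 (ord0 : 'I_5, ord0)).
apply: wins_wordW.
have -> : @word 4 3 [ffun => None] = nseq 5 None.
  by rewrite /word enum_ord5 /= !ffunE.
(* Call by need prunes illegal branches, whereas [vm_compute] would evaluate
   both arguments of [&&] and [==>]. *)
by lazy.
Qed.
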